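(* The tail order $\preceq$ is total when restricted to each of the following classes of probability measures with compact support in $[0,\infty)$: (i) those with constant densities; (ii) those with polynomial densities; (iii) those with analytic densities; (iv) those with piecewise constant, piecewise polynomial, or piecewise analytic densities. That is, for any two measures $\mu_1,\mu_2$ in the given class, $\mu_1\preceq\mu_2$ or $\mu_2\preceq\mu_1$.
   Context: $\mathbb{N}$ is the set of natural numbers including $0$. For a finite positive Borel measure $\mu$ on $[0,\infty)$ all of whose moments $s_n(\mu)=\int_0^\infty t^n\,d\mu(t)$, $n\in\mathbb{N}$, exist, the tail relation is defined by: $\mu_1\preceq\mu_2$ if and only if there is $n_0\in\mathbb{N}$ such that $s_n(\mu_1)\le s_n(\mu_2)$ for all $n\ge n_0$. Densities are with respect to Lebesgue measure. A measure has a constant (polynomial, analytic) density if there is a compact interval $[a,b]\subset[0,\infty)$ such that its density vanishes outside $[a,b]$ and coincides on $[a,b]$ with a constant (a polynomial, a function that is real analytic on a neighbourhood of $[a,b]$). The interval may depend on the measure. ''Piecewise'' means that $[a,b]$ can be divided into finitely many subintervals such that on each of them the density is (up to values at endpoints) of the respective type, analytic again meaning analytic on a neighbourhood of the closed subinterval. *)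

(* Defs.v *)
From HB Require Import structures.
From mathcomp Require Import all_boot all_order all_algebra.
From mathcomp Require Import all_classical all_reals all_analysis.

Set Implicit Arguments.
Unset Strict Implicit.
Unset Printing Implicit Defensive.

Import Order.TTheory GRing.Theory Num.Theory.
Import numFieldNormedType.Exports.

Local Open Scope classical_set_scope.
Local Open Scope ring_scope.

(* Measures on [0, +oo[ are represented by measures on R that vanish on the
   complement of [0, +oo[ (this is part of [compact_support] below). *)
Definition borel_finite_measure (R : realType) :=
  {finite_measure set (measurableTypeR R) -> \bar R}.

Definition borel_probability (R : realType) := probability (measurableTypeR R) R.

(* The integrand is nonnegative, so this is meaningful for every mu; it is
   finite exactly when the moment exists. *)
Definition moment (R : realType) (mu : borel_finite_measure R) (n : nat) :
    \bar R :=
  \int[mu]_(t in `[0, +oo[%classic) ((t : R) ^+ n)%:E.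

Definition tail_le (R : realType) (mu1 mu2 : borel_finite_measure R) : Prop :=
  exists n0 : nat, forall n : nat, (n0 <= n)%N ->
    (moment mu1 n <= moment mu2 n)%E.

Definition tail_total_on (R : realType) (C : set (borel_probability R)) : Prop :=
  total_on C (fun mu1 mu2 => tail_le mu1 mu2).

Definition compact_support (R : realType) (mu : borel_probability R) : Prop :=
  exists K : set R, [/\ compact K, K `<=` `[0, +oo[ & mu (~` K) = 0%E].

Definition has_density (R : realType) (mu : borel_probability R) (f : R -> R) :
    Prop :=
  [/\ measurable_fun [set: measurableTypeR R] f, forall x, 0 <= f x &
      forall A : set (measurableTypeR R), measurable A ->
        mu A = (\int[lebesgue_measure]_(x in A) (f x)%:E)%E].

Definition real_analytic_at (R : realType) (g : R -> R) (x : R) : Prop :=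
  exists2 r : R, 0 < r &
    exists c : R^nat, forall y : R, `|y - x| < r ->
      pseries c (y - x) @ \oo --> g y.

(* A type P of functions is a predicate [P a b g]: g is of that type on [a, b]
   (for the analytic type: on a neighbourhood of [a, b]). *)
Definition constant_type (R : realType) (a b : R) (g : R -> R) : Prop :=
  exists c : R, forall x, x \in `[a, b] -> g x = c.

Definition polynomial_type (R : realType) (a b : R) (g : R -> R) : Prop :=
  exists p : {poly R}, forall x, x \in `[a, b] -> g x = p.[x].

Definition analytic_type (R : realType) (a b : R) (g : R -> R) : Prop :=
  exists U : set R, [/\ open U, `[a, b] `<=` U &
    forall x, U x -> real_analytic_at g x].

(* A density is only determined almost everywhere: some version f of it is
   required to have the prescribed shape. *)
Definition density_of_type (R : realType)
    (P : R -> R -> (R -> R) -> Prop) : set (borel_probability R) :=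
  [set mu | compact_support mu /\
    exists f : R -> R, has_density mu f /\
    exists a b : R, [/\ 0 <= a, a <= b,
      forall x, x \notin `[a, b] -> f x = 0 &
      exists2 g : R -> R, P a b g & forall x, x \in `[a, b] -> f x = g x]].

(* The subintervals are cut out by a = t_0 < t_1 < ... < t_k = b with
   s = [:: t_1; ...; t_k]; the values of f at the t_i are unconstrained. *)
Definition piecewise_density_of_type (R : realType)
    (P : R -> R -> (R -> R) -> Prop) : set (borel_probability R) :=
  [set mu | compact_support mu /\
    exists f : R -> R, has_density mu f /\
    exists a b : R, [/\ 0 <= a, a <= b,
      forall x, x \notin `[a, b] -> f x = 0 &
      exists2 s : seq R, itv_partition a b s &
        forall i : nat, (i < size s)%N ->
          let c := nth b (a :: s) i in let d := nth b s i in
          exists2 g : R -> R, P c d g &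
            forall x, x \in `]c, d[ -> f x = g x]].

(* Main.v *)
Require Import Defs.
From mathcomp Require Import all_boot all_order all_algebra.
From mathcomp Require Import all_classical all_reals all_analysis.
From mathcomp Require Import measurable_realfun.
From mathcomp Require Import lra ring.

(** Let f1 and f2 be the densities and h = f1 - f2. The factor t ^+ n gives
   almost all the weight to the right end of the support, so for large n the
   sign of the integral of t ^+ n * h t is the sign of h immediately to the left
   of the last point beyond which h vanishes almost everywhere.

   What has to be shown is that h has a sign there. In each of the classes a
   density is, immediately to the left of every point x, the sum of a power
   series in t - x ([piecewise_left_power_series]); the difference of two such
   functions has the same property, however their partitions interleave. A
   power series vanishes identically or has, close to its centre and on one
   side of it, the sign of its first nonzero term; hence h is positive, negative
   or zero throughout some ]x - d, x[ ([left_power_series_sign]).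

   Let x be the infimum of the nonnegative points beyond which h = 0 almost
   everywhere. By countable additivity h = 0 almost everywhere beyond x. If
   x = 0, the moments coincide. If x > 0, then h cannot vanish on ]x - d, x[, as
   x would not be the infimum; say that h > 0 there, and let
   x - d <= p < q < x with p >= 0. Then the nth moment of the part of mu2 on
   [0, p] is at most p ^+ n, whereas beyond p the measure mu1 exceeds mu2 by at
   least q ^+ n times the integral of h over ]q, x[. The latter wins for large n
   ([tail_le_of_density]). *)

Set Implicit Arguments.
Unset Strict Implicit.
Unset Printing Implicit Defensive.

Import Order.TTheory GRing.Theory Num.Theory.
Import numFieldNormedType.Exports.

Local Open Scope classical_set_scope.
Local Open Scope ring_scope.

(** * The sign of a power series near its centre *)

(** Since t <= 1/2, the terms after the mth add up to at least
   - 2 * M * t ^+ m.+1, which is at most half of the mth term in size. *)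
Lemma series_lead_gt0 (R : realType) (a : R^nat) (M t l : R) (m : nat) :
  (forall i, `|a i| <= M) -> (forall i, (i < m)%N -> a i = 0) -> 0 < a m ->
  0 < t -> t <= 2^-1 -> 4 * M * t <= a m ->
  pseries a t @ \oo --> l -> 0 < l.
Proof.
move=> aM a0 am t0 t2 Mt sl.
have M0 : 0 <= M by apply: le_trans (aM 0%N).
(* The last summand is what makes the induction on the length go through. *)
have lower k :
    a m * t ^+ m - 2 * M * t ^+ m.+1 + 2 * M * t ^+ (k + m.+1) <=
    pseries a t (k + m.+1)%N.
  elim: k => [|k IH].
    rewrite add0n subrK /pseries /series /= big_nat_recr//= big_nat_cond.
    rewrite big1 ?add0r//.
    by move=> i /andP[/andP[_ im] _]; rewrite a0 ?mul0r.
  rewrite addSn (_ : pseries a t _ =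
    pseries a t (k + m.+1)%N + a (k + m.+1)%N * t ^+ (k + m.+1)); last first.
    by rewrite /pseries /series /= big_nat_recr.
  have tk : 0 <= t ^+ (k + m.+1) by rewrite exprn_ge0// ltW.
  have hA : - M * t ^+ (k + m.+1) <= a (k + m.+1)%N * t ^+ (k + m.+1).
    rewrite ler_wpM2r// lerNl (le_trans _ (aM (k + m.+1)%N))//.
    by rewrite ler_normr lexx orbT.
  have hM : 0 <= M * t ^+ (k + m.+1) * (1 - 2 * t).
    by rewrite !mulr_ge0//; lra.
  move: IH hA hM; rewrite [t ^+ (k + m.+1).+1]exprS.
  move: (t ^+ (k + m.+1)) (a (k + _)%N) (pseries _ _ _) (a m * _ - _).
  move=> T A P X.
  lra.
have tm : 0 < t ^+ m by rewrite exprn_gt0.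
apply: (@lt_le_trans _ _ (a m * t ^+ m / 2)); first nra.
suff: a m * t ^+ m / 2 <= lim (pseries a t @ \oo) by rewrite (cvg_lim _ sl).
apply: limr_ge; first by apply/cvg_ex; exists l.
exists m.+1 => // n /= mn; rewrite -(subnK mn); apply: le_trans (lower _).
have : 0 <= 2 * M * t ^+ (n - m.+1 + m.+1).
  by rewrite !mulr_ge0// exprn_ge0// ltW.
by rewrite exprS; nra.
Qed.

(** Convergence at z bounds the coefficients c i * z ^+ i of the series rescaled
   by z, whose variable t is then positive whatever the sign of z. *)
Lemma pseries_left_germ_gt0 (R : realType) (c : R^nat) (z : R) (m : nat) :
  cvgn (pseries c z) -> (forall i, (i < m)%N -> c i = 0) -> 0 < c m * z ^+ m ->
  exists2 d, 0 < d & forall t l, 0 < t -> t < d ->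
    pseries c (t * z) @ \oo --> l -> 0 < l.
Proof.
move=> cz c0 cm.
pose a i := c i * z ^+ i.
have [M [_ HM]] := cvg_seq_bounded (cvgP _ (cvg_series_cvg_0 cz)).
have {}HM i : `|a i| <= `|M| + 1.
  by apply: (HM (`|M| + 1)) => //; rewrite ltr_pwDr// ler_norm.
set M' := `|M| + 1 in HM.
have M'0 : 0 < M' by rewrite ltr_pwDr.
exists (Num.min 2^-1 (a m / (4 * M'))) => [|t l t0].
  by rewrite lt_min invr_gt0 ltr0n/= divr_gt0// mulr_gt0.
rewrite lt_min => /andP[t2 tM] pl.
apply: (@series_lead_gt0 _ a M' t l m) => //.
- by move=> i im; rewrite /a c0// mul0r.
- exact: ltW.
- by move: tM; rewrite ltr_pdivlMr ?mulr_gt0// mulrC => /ltW.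
rewrite (_ : pseries a t = pseries c (t * z))//.
rewrite /pseries; congr series; apply/funext => i /=; rewrite /a exprMn; ring.
Qed.

Lemma pseriesN (R : realType) (c : R^nat) (z : R) :
  pseries (fun i => - c i) z = - pseries c z.
Proof.
apply/funext => n; transitivity (- pseries c z n); last by [].
rewrite /pseries /series /= -sumrN.
by apply: eq_bigr => i _; rewrite mulNr.
Qed.

(** Expansions are asked for on the left of x only: at a point where two pieces
   of a piecewise analytic function meet, the left piece still provides one. *)
Definition left_power_series (R : realType) (f : R -> R) (x : R) : Prop :=
  exists2 r : R, 0 < r &
    exists c : R^nat, forall y : R, x - r < y < x ->
      pseries c (y - x) @ \oo --> f y.

Lemma left_power_seriesB (R : realType) (f g : R -> R) (x : R) :
  left_power_series f x -> left_power_series g x ->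
  left_power_series (f \- g) x.
Proof.
move=> [r r0 [c cf]] [s s0 [e eg]].
exists (Num.min r s); first by rewrite lt_min r0.
exists (c \- e) => y /andP[y1 yx].
have yr : x - r < y < x.
  by rewrite yx andbT (le_lt_trans _ y1)// lerD2l lerN2 ge_min lexx.
have ys : x - s < y < x.
  by rewrite yx andbT (le_lt_trans _ y1)// lerD2l lerN2 ge_min lexx orbT.
have <- : pseries c (y - x) - pseries e (y - x) = pseries (c \- e) (y - x).
  apply/funext => n; transitivity (pseries c (y - x) n - pseries e (y - x) n).
    by [].
  rewrite /pseries /series /= -sumrB.
  by apply: eq_bigr => i _; rewrite mulrBl.
by apply: cvgB; [exact: cf|exact: eg].
Qed.

(** The sign is that of the first nonzero term. A point x + z with z < 0 at
   which the series converges serves as the unit of length. *)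
Lemma left_power_series_sign (R : realType) (f : R -> R) (x : R) :
  left_power_series f x ->
  exists2 d : R, 0 < d &
    [\/ forall y, x - d < y < x -> f y = 0,
        forall y, x - d < y < x -> 0 < f y |
        forall y, x - d < y < x -> f y < 0].
Proof.
move=> [r r0 [c cf]].
have [c0|/existsNP[i0 /eqP ci0]] := pselect (forall i, c i = 0).
  exists r => //; constructor 1 => y /cf.
  have -> : pseries c (y - x) = cst 0.
    apply/funext => n; rewrite /pseries /series /= big1// => i _.
    by rewrite c0 mul0r.
  by move=> /cvg_lim <- //; rewrite lim_cst.
have exm : exists i, c i != 0 by exists i0.
case: (ex_minnP exm) => m cm minm {i0 ci0 exm}.
have cm0 i : (i < m)%N -> c i = 0.
  by move=> im; apply/eqP; apply: contraTT im => /minm; rewrite leqNgt.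
pose z := - (r / 2).
have z0 : z < 0 by rewrite oppr_lt0 divr_gt0.
have cz : pseries c z @ \oo --> f (x + z).
  by have := cf (x + z); rewrite addrAC subrr add0r; apply; rewrite /z; lra.
have cvz : cvgn (pseries c z) by apply/cvg_ex; eexists; exact: cz.
have scale y d : 0 < d -> x - Num.min r (d * (r / 2)) < y < x ->
    [/\ x - r < y < x, 0 < (y - x) / z, (y - x) / z < d &
        (y - x) / z * z = y - x].
  move=> d0 /andP[y1 yx]; split.
  - by rewrite yx andbT (le_lt_trans _ y1)// lerD2l lerN2 ge_min lexx.
  - by rewrite nmulr_rgt0 ?invr_lt0// subr_lt0.
  - rewrite ltr_ndivrMr// /z mulrN ltrBrDr addrC (le_lt_trans _ y1)// lerD2l.
    by rewrite lerN2 ge_min lexx orbT.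
  - by rewrite divfK// lt_eqF.
have min0 d : 0 < d -> 0 < Num.min r (d * (r / 2)).
  by move=> d0; rewrite lt_min r0/= mulr_gt0// divr_gt0.
have cmz : c m * z ^+ m != 0 by rewrite mulf_neq0// expf_neq0// lt_eqF.
have [cmz0|cmz0|/eqP] := ltrgt0P (c m * z ^+ m); last by rewrite (negbTE cmz).
- have [d d0 dP] := pseries_left_germ_gt0 cvz cm0 cmz0.
  exists (Num.min r (d * (r / 2))); first exact: min0.
  constructor 2 => y /(scale _ _ d0)[/cf yr t0 td tz].
  by apply: (dP _ _ t0 td); rewrite tz.
- have [|||d d0 dP] := @pseries_left_germ_gt0 _ (fun i => - c i) z m.
  + by rewrite pseriesN; apply: is_cvgN.
  + by move=> i im; rewrite cm0// oppr0.
  + by rewrite mulNr oppr_gt0.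
  exists (Num.min r (d * (r / 2))); first exact: min0.
  constructor 3 => y /(scale _ _ d0)[/cf yr t0 td tz].
  by rewrite -oppr_gt0; apply: (dP _ _ t0 td); rewrite tz pseriesN; apply: cvgN.
Qed.

(** * Left expansions of the densities *)

Lemma left_power_series_local (R : realType) (f g : R -> R) (w x : R) :
  w < x -> (forall y, w < y < x -> f y = g y) ->
  left_power_series g x -> left_power_series f x.
Proof.
move=> wx fg [r r0 [c cg]].
exists (Num.min r (x - w)); first by rewrite lt_min r0/= subr_gt0.
exists c => y /andP[y1 yx].
rewrite fg; last first.
  rewrite yx andbT (le_lt_trans _ y1)// lerBrDr addrC -lerBrDr.
  by rewrite ge_min lexx orbT.
apply: cg; rewrite yx andbT (le_lt_trans _ y1)//.
by rewrite lerD2l lerN2 ge_min lexx.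
Qed.

Lemma polynomial_left_power_series (R : realType) (p : {poly R}) (x : R) :
  left_power_series (horner p) x.
Proof.
exists 1 => //; exists (fun i => (p \Po ('X + x%:P))`_i) => y _.
have <- : (p \Po ('X + x%:P)).[y - x] = p.[y].
  by rewrite horner_comp !hornerE subrK.
set q := _ \Po _.
apply: cvg_near_cst; exists (size q) => // n /= qn.
rewrite /pseries /series /= big_mkord horner_coef.
rewrite (big_ord_widen _ (fun i => q`_i * (y - x) ^+ i) qn).
rewrite [RHS]big_mkcond; apply: eq_bigr => i _; case: ltnP => // ni.
by rewrite nth_default// mul0r.
Qed.

Definition left_analytic_type (R : realType)
    (P : R -> R -> (R -> R) -> Prop) : Prop :=
  forall a b g x, P a b g -> a < x -> x <= b -> left_power_series g x.

Lemma polynomial_left_analytic (R : realType) :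
  left_analytic_type (@polynomial_type R).
Proof.
move=> a b g x [p gp] ax xb.
apply: (left_power_series_local ax) (polynomial_left_power_series p x) => y.
by move=> /andP[ay yx]; apply: gp; rewrite in_itv/= (ltW ay) (le_trans (ltW yx)).
Qed.

Lemma constant_left_analytic (R : realType) :
  left_analytic_type (@constant_type R).
Proof.
move=> a b g x [c gc]; apply: polynomial_left_analytic.
by exists c%:P => y yab; rewrite hornerC gc.
Qed.

Lemma analytic_left_analytic (R : realType) :
  left_analytic_type (@analytic_type R).
Proof.
move=> a b g x [U [_ abU gU]] ax xb.
have [|r r0 [c cg]] := gU x.
  by apply: abU; rewrite /= in_itv/= (ltW ax).
exists r => //; exists c => y /andP[y1 yx]; apply: cg.
by rewrite ltr_norml; apply/andP; split; lra.
Qed.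

Lemma partition_cover (R : realType) (s : seq R) (a b x : R) :
  a < x -> x <= last a s ->
  exists2 i, (i < size s)%N & nth b (a :: s) i < x <= nth b s i.
Proof.
elim: s a => [|h s IH] a /= ax xl.
  by have := lt_le_trans ax xl; rewrite ltxx.
have [xh|hx] := leP x h; first by exists 0%N => //=; rewrite ax.
by have [i si xi] := IH h hx xl; exists i.+1.
Qed.

(** A degenerate interval a = b is cut into no piece at all. *)
Lemma piecewise_of_type (R : realType) (P : R -> R -> (R -> R) -> Prop) :
  density_of_type P `<=` piecewise_density_of_type P.
Proof.
move=> mu [cmu [f [fd [a [b [a0 ab f0 [g Pg fg]]]]]]].
split => //; exists f; split => //; exists a, b; split => //.
move: ab; rewrite le_eqVlt => /predU1P[ab|ab].
  by exists [::] => //; split => //=; rewrite ab.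
exists [:: b]; first exact: itv_partition1.
move=> [|i]//= _; exists g => // x; rewrite in_itv/= => /andP[ax xb].
by apply: fg; rewrite in_itv/= !ltW.
Qed.

(** Each x in ]a, b] lies in some ]c, d] of the partition, and to the left of x
   the density is then a function of the given type on [c, d]; elsewhere the
   density vanishes to the left of x. *)
Lemma piecewise_left_power_series (R : realType)
    (P : R -> R -> (R -> R) -> Prop) (mu : borel_probability R) :
  left_analytic_type P -> piecewise_density_of_type P mu ->
  exists f b, [/\ has_density mu f, forall x, b < x -> f x = 0 &
    forall x, left_power_series f x].
Proof.
move=> lP [_ [f [fd [a [b [_ _ f0 [s [_ /eqP sb] sP]]]]]]].
have zero w x : w < x -> (forall y, w < y < x -> f y = 0) ->
    left_power_series f x.
  move=> wx fz.
  apply: (left_power_series_local wx) (polynomial_left_power_series 0 x) => y.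
  by move=> /fz ->; rewrite horner0.
exists f, b; split => // [x bx|x].
  by apply: f0; rewrite in_itv/= negb_and -!ltNge bx orbT.
have [xa|ax] := leP x a.
  apply: (zero (x - 1)) => [|y /andP[_ yx]]; first by rewrite ltrBlDr ltrDl.
  by apply: f0; rewrite in_itv/= negb_and -!ltNge (lt_le_trans yx xa).
have [xb|bx] := leP x b; last first.
  apply: (zero b) => // y /andP[yx _].
  by apply: f0; rewrite in_itv/= negb_and -!ltNge yx orbT.
rewrite -sb in xb; have [i si /andP[cx xd]] := partition_cover b ax xb.
have [g Pg fg] := sP i si.
apply: (left_power_series_local cx) (lP _ _ _ _ Pg cx xd) => y /andP[cy yx].
by apply: fg; rewrite in_itv/= cy (lt_le_trans yx).
Qed.

(** * Moments in terms of densities *)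

Section densities.
Context {R : realType}.
Implicit Types (mu : borel_probability R) (f : R -> R).
Local Notation leb := (@lebesgue_measure R).

Lemma density_null_dominates mu f : has_density mu f -> mu `<< leb.
Proof.
move=> [mf f0 muE]; apply/null_content_dominatesP => A mA A0.
rewrite muE//; under eq_integral do rewrite -(ger0_norm (f0 _)) -abse_EFin.
by apply: integral_abs_eq0 => //; exact/measurable_EFinP/measurable_funTS.
Qed.

(** The density f coincides almost everywhere with the Radon-Nikodym derivative
   of mu, for which the change of variables is known. *)
Lemma density_integral mu f (E : set (measurableTypeR R)) n :
  has_density mu f -> measurable E -> E `<=` `[0, +oo[ ->
  (\int[mu]_(t in E) ((t : R) ^+ n)%:E =
   \int[leb]_(t in E) (t ^+ n * f t)%:E)%E.
Proof.
move=> fd mE E0; have dom := density_null_dominates fd; have [mf f0 muE] := fd.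
have E0' t : t \in E -> 0 <= t by move=> /set_mem/E0 /=; rewrite in_itv/= andbT.
(* The absolute value makes the integrand nonnegative on the whole line. *)
pose g (t : measurableTypeR R) := (`|t| ^+ n)%:E.
have mg : measurable_fun [set: measurableTypeR R] g.
  apply/measurable_EFinP; apply: measurable_funX.
  exact: normr_measurable.
transitivity (\int[mu]_(t in E) g t)%E.
  by apply: eq_integral => t tE; rewrite /g ger0_norm// E0'.
rewrite -(Radon_Nikodym_SigmaFinite.change_of_variables dom)//; last 2 first.
- by move=> t; rewrite /g lee_fin exprn_ge0.
- exact: measurable_funTS.
have RN := Radon_Nikodym_SigmaFinite.f_integrable dom.
have mRN := measurable_int _ RN.
transitivity (\int[leb]_(t in E) (g t * (f t)%:E))%E; last first.
  by apply: eq_integral => t tE; rewrite /g ger0_norm ?E0'.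
apply: ge0_ae_eq_integral => //.
- by apply: emeasurable_funM; apply: measurable_funTS.
- by apply: emeasurable_funM; apply: measurable_funTS => //; exact/measurable_EFinP.
- move=> t _; rewrite mule_ge0 ?lee_fin ?exprn_ge0//.
  exact: Radon_Nikodym_SigmaFinite.f_ge0.
- by move=> t _; rewrite mule_ge0 ?lee_fin ?exprn_ge0.
apply: ae_eqe_mul2l; apply: integral_ae_eq => //.
- exact: integrableS RN.
- exact/measurable_funTS/measurable_EFinP.
- move=> A AE mA.
  by rewrite -muE// -Radon_Nikodym_SigmaFinite.f_integral.
Qed.

End densities.
(** * Comparison of moments of high order *)

Lemma expr_eventually_dominated {R : realType} (p q e : R) :
  0 <= p -> p < q -> 0 < e ->
  exists n0, forall n, (n0 <= n)%N -> p ^+ n <= q ^+ n * e.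
Proof.
move=> p0 pq e0; have q0 : 0 < q by apply: le_lt_trans pq.
have : (p / q) ^+ n @[n --> \oo] --> 0.
  apply: cvg_expr; rewrite ger0_norm ?divr_ge0 ?(ltW q0)//.
  by rewrite ltr_pdivrMr ?mul1r.
move=> /cvgrPdist_le/(_ _ e0)[n0 _ h]; exists n0 => n /h /=.
rewrite sub0r normrN expr_div_n ger0_norm ?divr_ge0 ?exprn_ge0 ?(ltW q0)//.
by rewrite ler_pdivrMr ?exprn_gt0// mulrC.
Qed.

#[local] Instance lebesgue_ae_filter (R : realType) :
  Filter (nbhs (almost_everywhere (@lebesgue_measure R))).
Proof. exact: ae_filter_ringOfSetsType. Qed.

Lemma ae_neq (R : realType) (x : R) :
  {ae @lebesgue_measure R, forall t, t != x}.
Proof.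
exists [set x]; split => //; first exact: lebesgue_measure_set1.
by move=> t /= /negP; rewrite negbK => /eqP.
Qed.

Section tail_comparison.
Context {R : realType}.
Variables (mu1 mu2 : borel_probability R) (f1 f2 : R -> R).
Hypotheses (fd1 : has_density mu1 f1) (fd2 : has_density mu2 f2).
Local Notation leb := (@lebesgue_measure R).

Lemma moment_split (mu : borel_probability R) (p : R) n : 0 <= p ->
  moment mu n = (\int[mu]_(t in `[0%R, p]) ((t : R) ^+ n)%:E +
                 \int[mu]_(t in `]p, +oo[) ((t : R) ^+ n)%:E)%E.
Proof.
move=> p0; rewrite /moment.
have -> : `[0%R, +oo[%classic = `[0%R, p] `|` `]p, +oo[ :> set R.
  by rewrite -itv_bndbnd_setU// bnd_simp.
apply: ge0_integral_setU => //.
- by apply/measurable_EFinP/measurable_funTS/measurable_funX.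
- move=> t; rewrite /= !in_itv/= andbT lee_fin => -[/andP[t0 _]|pt].
    by rewrite exprn_ge0.
  by rewrite exprn_ge0// (le_trans p0)// ltW.
- apply/disj_setPS => t [/=]; rewrite !in_itv/= andbT => /andP[_ tp] pt.
  by move: (lt_le_trans pt tp); rewrite ltxx.
Qed.

(** Almost everywhere on ]p, +oo[ one has f1 >= f2 + k, where k is the
   difference of the densities cut off to ]q, x[. Hence the nth moment of mu1 over
   ]p, +oo[ exceeds that of mu2 by q ^+ n * eps, with eps the integral of k,
   while [0, p] contributes at most p ^+ n to the moment of mu2. *)
Lemma tail_le_of_density (p x : R) : 0 <= p -> p < x ->
  {ae leb, forall t, x < t -> f1 t = f2 t} ->
  (forall t, p < t < x -> f2 t < f1 t) -> tail_le mu2 mu1.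
Proof.
move=> p0 px f12 f21; have [mf1 f10 _] := fd1; have [mf2 f20 _] := fd2.
pose q := (p + x) / 2.
have pq : p < q by rewrite /q; lra.
have qx : q < x by rewrite /q; lra.
have q0 : 0 < q by apply: le_lt_trans pq.
pose D : set R := `]p, +oo[%classic.
pose I : set R := `]q, x[%classic.
pose k := (f1 \- f2) \_ I.
have mI : measurable I by exact: measurable_itv.
have ID : I `<=` D.
  by move=> t; rewrite /I /D /= !in_itv/= andbT => /andP[qt _]; apply: lt_trans qt.
have mk : measurable_fun setT k.
  apply/(measurable_restrictT _ _).1 => //.
  by apply: measurable_funTS; exact: measurable_funB.
have kpos t : I t -> 0 < k t.
  move=> It; rewrite /k patchE mem_set//= subr_gt0 f21//.
  by move: It; rewrite /I /= in_itv/= => /andP[qt ->]; rewrite (lt_trans pq qt).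
have k0 t : 0 <= k t.
  have [It|It] := pselect (I t); first exact/ltW/kpos.
  by rewrite /k patchE memNset.
pose eps := (\int[leb]_(t in D) (k t)%:E)%E.
have eps0 : (0 < eps)%E.
  rewrite lt_neqAle integral_ge0 ?andbT; last by move=> t _; rewrite lee_fin.
  apply/eqP => /esym eps0.
  have mkD : measurable_fun D (EFin \o k).
    exact/measurable_EFinP/measurable_funTS.
  have : (\int[leb]_(t in D) `|(EFin \o k) t|)%E = 0%E.
    by rewrite -eps0; apply: eq_integral => t _; rewrite gee0_abs// lee_fin.
  move/(ae_eq_integral_abs leb (measurable_itv _) mkD) => [N [mN N0 kN]].
  have : (leb I <= leb N)%E.
    apply: le_measure; rewrite ?inE//; apply: subset_trans kN => t It /=.
    by move=> /(_ (ID _ It)) [] kt; have := kpos _ It; rewrite kt ltxx.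
  by rewrite N0 /I lebesgue_measure_itv/= lte_fin qx lee_fin subr_le0 leNgt qx.
(* A priori eps may be infinite. *)
have [e e0 e_eps] : exists2 e : R, 0 < e & (e%:E <= eps)%E.
  case: eps eps0 => [r| |]//; last by exists 1; rewrite ?leey.
  by rewrite lte_fin; exists r.
have [n0 pqn] := expr_eventually_dominated p0 pq e0.
exists n0 => n /pqn pqe.
have mX : measurable_fun [set: R] (fun t => t ^+ n) by exact: measurable_funX.
have D0 : D `<=` `[0, +oo[.
  by move=> t; rewrite /D /= !in_itv/= !andbT => /ltW; apply: le_trans.
have Xge0 t : D t -> 0 <= t ^+ n.
  by move=> /D0 /=; rewrite in_itv/= andbT => /exprn_ge0; apply.
have mD : measurable (D : set (measurableTypeR R)) by exact: measurable_itv.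
rewrite (moment_split mu1 n p0) (moment_split mu2 n p0).
rewrite -/D (density_integral n fd1 mD D0) (density_integral n fd2 mD D0).
apply: (@le_trans _ _ (\int[leb]_(t in D) (t ^+ n * f1 t)%:E)%E); last first.
  apply: leeDr; apply: integral_ge0 => t /=.
  by rewrite in_itv/= => /andP[t0 _]; rewrite lee_fin exprn_ge0.
apply: (@le_trans _ _ ((p ^+ n)%:E + \int[leb]_(t in D) (t ^+ n * f2 t)%:E)%E).
  apply: leeD2r.
  apply: (@le_trans _ _ (\int[mu2]_(t in `[0%R, p]) (cst (p ^+ n)%:E t))%E).
    apply: ge0_le_integral => //.
    - by move=> t /=; rewrite in_itv/= => /andP[t0 _]; rewrite lee_fin exprn_ge0.
    - exact/measurable_EFinP/measurable_funTS.
    - move=> t /=; rewrite in_itv/= => /andP[t0 tp].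
      by rewrite lee_fin lerXn2r// nnegrE.
  rewrite integral_cst//= -[leRHS]mule1 lee_wpmul2l ?lee_fin ?exprn_ge0//.
  exact: probability_le1.
apply: (@le_trans _ _ (\int[leb]_(t in D) ((q ^+ n)%:E * (k t)%:E) +
                       \int[leb]_(t in D) (t ^+ n * f2 t)%:E)%E).
  apply: leeD2r; rewrite ge0_integralZl//.
  - apply: (@le_trans _ _ ((q ^+ n)%:E * e%:E)%E); first by rewrite -EFinM lee_fin.
    by rewrite lee_wpmul2l// lee_fin exprn_ge0// ltW.
  - exact/measurable_EFinP/measurable_funTS.
  - by move=> t _; rewrite lee_fin.
  - by rewrite lee_fin exprn_ge0// ltW.
rewrite -ge0_integralD//; first last.
- exact/measurable_EFinP/measurable_funTS/measurable_funM.
- by move=> t Dt; rewrite lee_fin mulr_ge0// Xge0.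
- apply/measurable_EFinP/measurable_funTS/measurable_funM => //.
- by move=> t Dt; rewrite mule_ge0 ?lee_fin ?exprn_ge0// ltW.
apply: ae_ge0_le_integral => //.
- move=> t Dt; rewrite adde_ge0 ?mule_ge0 ?lee_fin ?mulr_ge0 ?(Xge0 t)//.
  by rewrite exprn_ge0// ltW.
- apply/measurable_EFinP/measurable_funTS/measurable_funD.
    exact: measurable_funM.
  exact: measurable_funM.
- by move=> t Dt; rewrite lee_fin mulr_ge0// Xge0.
- exact/measurable_EFinP/measurable_funTS/measurable_funM.
move: f12 (ae_neq x); apply: filterS2 => t f12 tx Dt.
rewrite -EFinM -EFinD lee_fin.
have [It|nIt] := pselect (I t).
  rewrite /k patchE mem_set//= -lerBrDr -mulrBr ler_wpM2r//.
    by have := kpos _ It; rewrite /k patchE mem_set// => /ltW.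
  move: It; rewrite /I /= in_itv/= => /andP[qt _].
  by rewrite lerXn2r ?nnegrE ?(ltW q0) ?(ltW qt)// ltW// (lt_trans q0).
rewrite /k patchE memNset// mulr0 add0r ler_wpM2l ?Xge0//.
move: tx; rewrite neq_lt => /orP[tx|xt]; last by rewrite f12.
apply/ltW/f21; rewrite tx andbT.
by move: Dt; rewrite /D /= in_itv/= andbT.
Qed.

End tail_comparison.

(** * Totality *)

Lemma ae_eq_above_of_gt (R : realType) (f g : R -> R) (x : R) :
  (forall y, x < y -> {ae @lebesgue_measure R, forall t, y < t -> f t = g t}) ->
  {ae @lebesgue_measure R, forall t, x < t -> f t = g t}.
Proof.
move=> H.
have H' n : {ae @lebesgue_measure R, forall t, x + n.+1%:R^-1 < t -> f t = g t}.
  by apply: H; rewrite ltrDl.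
have := ae_foralln H'; apply: filterS => t Ht xt.
have tx0 : 0 < t - x by rewrite subr_gt0.
have [n _ Hn] := near_infty_natSinv_lt (PosNum tx0).
by apply: (Ht n); rewrite -ltrBrDl; exact: (Hn n (leqnn n)).
Qed.

(** The sign of f1 - f2 decides immediately to the left of the infimum x of the
   nonnegative points beyond which f1 = f2 almost everywhere. *)
Lemma tail_le_total (R : realType) (mu1 mu2 : borel_probability R)
    (f1 f2 : R -> R) (b1 b2 : R) :
  has_density mu1 f1 -> has_density mu2 f2 ->
  (forall x, b1 < x -> f1 x = 0) -> (forall x, b2 < x -> f2 x = 0) ->
  (forall x, left_power_series f1 x) -> (forall x, left_power_series f2 x) ->
  tail_le mu1 mu2 \/ tail_le mu2 mu1.
Proof.
move=> fd1 fd2 f10 f20 an1 an2.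
pose S := [set x : R | 0 <= x /\
  {ae @lebesgue_measure R, forall t, x < t -> f1 t = f2 t}].
have S0 : S !=set0.
  exists (Num.max 0 (Num.max b1 b2)); split; first by rewrite le_max lexx.
  apply: aeW => t; rewrite !gt_max => /and3P[_ b1t b2t].
  by rewrite f10// f20.
have lbS : has_lbound S by exists 0 => x [].
have inf0 : 0 <= inf S by apply: lb_le_inf => // x [].
have infS : {ae @lebesgue_measure R, forall t, inf S < t -> f1 t = f2 t}.
  apply: ae_eq_above_of_gt => y infy.
  have [z [z0 Sz] zy] := inf_lt S0 infy.
  by move: Sz; apply: filterS => t zt yt; apply: zt; exact: lt_trans yt.
set x := inf S in inf0 infS.
move: inf0; rewrite le_eqVlt => /predU1P[x0|x0].
  left; exists 0%N => n _; rewrite le_eqVlt; apply/orP; left; apply/eqP.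
  have [mf1 f1ge0 _] := fd1; have [mf2 f2ge0 _] := fd2.
  rewrite /moment (density_integral n fd1 (measurable_itv _) (@subset_refl _ _)).
  rewrite (density_integral n fd2 (measurable_itv _) (@subset_refl _ _)).
  have mX : measurable_fun [set: R] (fun t => t ^+ n) by exact: measurable_funX.
  apply: ge0_ae_eq_integral => //.
  - exact/measurable_EFinP/measurable_funTS/measurable_funM.
  - exact/measurable_EFinP/measurable_funTS/measurable_funM.
  - move=> t /=; rewrite in_itv/= andbT => t0.
    by rewrite lee_fin mulr_ge0// exprn_ge0.
  - move=> t /=; rewrite in_itv/= andbT => t0.
    by rewrite lee_fin mulr_ge0// exprn_ge0.
  move: infS (@ae_neq R 0); apply: filterS2 => t; rewrite -x0 => infS t0 /=.
  rewrite in_itv/= andbT le_eqVlt eq_sym (negbTE t0)/= => /infS ->.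
  by [].
have [d d0 sgn] := left_power_series_sign (left_power_seriesB (an1 x) (an2 x)).
(* Only the part of ]x - d, x[ on the positive half-line is relevant. *)
pose p := Num.max 0 (x - d).
have p0 : 0 <= p by rewrite le_max lexx.
have px : p < x by rewrite gt_max x0/= ltrBlDr ltrDl.
have pd t : p < t < x -> x - d < t < x.
  by rewrite gt_max => /andP[/andP[_ ->] ->].
case: sgn => sgn.
- have : S p.
    split => //; move: infS (ae_neq x); apply: filterS2 => t xt tx pt.
    move: tx; rewrite neq_lt => /orP[tx|]; last exact: xt.
    by apply/eqP; rewrite -subr_eq0; apply/eqP/sgn/pd; rewrite pt.
  by move/(ge_inf lbS); rewrite leNgt px.
- right; apply: (tail_le_of_density fd1 fd2 p0 px) => // t /pd /sgn /=.
  by rewrite subr_gt0.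
- left; apply: (tail_le_of_density fd2 fd1 p0 px).
    by move: infS; apply: filterS => t /[apply].
  by move=> t /pd /sgn /=; rewrite subr_lt0.
Qed.

Lemma tail_total_on_piecewise (R : realType) (P : R -> R -> (R -> R) -> Prop) :
  left_analytic_type P -> tail_total_on (piecewise_density_of_type P).
Proof.
move=> lP mu1 mu2 mu1P mu2P.
have [f1 [b1 [fd1 f10 an1]]] := piecewise_left_power_series lP mu1P.
have [f2 [b2 [fd2 f20 an2]]] := piecewise_left_power_series lP mu2P.
exact: tail_le_total fd1 fd2 f10 f20 an1 an2.
Qed.

Lemma tail_total_on_subset (R : realType) (C D : set (borel_probability R)) :
  C `<=` D -> tail_total_on D -> tail_total_on C.
Proof.
by move=> CD totD mu1 mu2 /CD mu1D /CD; exact: totD.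
Qed.

Theorem corollary11 (R : realType) :
  tail_total_on (density_of_type (@constant_type R)) /\
  tail_total_on (density_of_type (@polynomial_type R)) /\
  tail_total_on (density_of_type (@analytic_type R)) /\
  tail_total_on (piecewise_density_of_type (@constant_type R)) /\
  tail_total_on (piecewise_density_of_type (@polynomial_type R)) /\
  tail_total_on (piecewise_density_of_type (@analytic_type R)).
Proof.
have totc := tail_total_on_piecewise (@constant_left_analytic R).
have totp := tail_total_on_piecewise (@polynomial_left_analytic R).
have tota := tail_total_on_piecewise (@analytic_left_analytic R).
by do ![split => //]; apply: tail_total_on_subset (@piecewise_of_type _ _) _.
Qed.
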